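(* Let $n=p^\ell m$, where $p$ is a prime and $\ell\geq 1$, $m\geq 2$ are integers. Then a connected circulant graph of order $n$ and degree $p^\ell - 1$ admits a perfect code if and only if it is isomorphic to a graph in $\mathcal{G}_{\mathbf{l}, \mathbf{m}}(n, p^\ell)$ for some sequences $\mathbf{l} = (\ell_1, \ldots, \ell_t)$, $\mathbf{m} = (m_1, \ldots, m_t)$ of positive integers satisfying $\sum_{i=1}^t \ell_i = \ell$ and $\prod_{i=1}^{t}m_i = m$.
   Context: For an inverse-closed $S\subseteq \mathbb{Z}_N\setminus\{0\}$, $\mathrm{Cay}(\mathbb{Z}_N,S)$ has vertex set $\mathbb{Z}_N$ with $x,y$ adjacent iff $x-y\in S$; $S_0=S\cup\{0\}$. A perfect code is a vertex set $D$ such that every vertex is at distance at most $1$ from exactly one vertex of $D$. Elements of $\mathbb{Z}_N$ are identified with integers in $\{0,\dots,N-1\}$. $K_{q}$ denotes $\mathrm{Cay}(\mathbb{Z}_{q},\mathbb{Z}_{q}\setminus\{0\})$. Lifts: let $\Gamma=\mathrm{Cay}(\mathbb{Z}_N,S)$ and $a\ge1$. A map $\sigma:S_0\to\{0,1,\dots,a-1\}$ is feasible if $\sigma(0)=0$ and $T(\sigma)=\{s+\sigma(s)N: s\in S\}$ satisfies $-T(\sigma)=T(\sigma)$ in $\mathbb{Z}_{aN}$. Then $\bar f_a(\Gamma)=\{\mathrm{Cay}(\mathbb{Z}_{aN},T(\sigma)): \sigma \text{ feasible}\}$, and $\bar g_a(\Gamma)=\mathrm{Cay}(\mathbb{Z}_{aN},T)$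 where $T\cup\{0\}=\{s+iN: s\in S_0, 0\le i\le a-1\}$. The family $\mathcal{G}_{\mathbf{l},\mathbf{m}}(n,p^\ell)$: given positive integer sequences $\mathbf{l}=(\ell_1,\dots,\ell_t)$, $\mathbf{m}=(m_1,\dots,m_t)$ with $\sum\ell_i=\ell$, $\prod m_i=m$, put $r=\ell_t$. Choose a connected graph $\Gamma_t\in\bar f_{m_t}(K_{p^r})$; set $\Sigma_{t-1}=\bar g_{p^{\ell_{t-1}}}(\Gamma_t)$ and choose a connected $\Gamma_{t-1}\in \bar f_{m_{t-1}}(\Sigma_{t-1})$; iterate: for $i=t-1,\dots,1$, $\Sigma_i=\bar g_{p^{\ell_i}}(\Gamma_{i+1})$ and $\Gamma_i$ is a connected graph in $\bar f_{m_i}(\Sigma_i)$. $\mathcal{G}_{\mathbf{l},\mathbf{m}}(n,p^\ell)$ is the set of all graphs $\Gamma_1$ obtainable in this way (all are connected circulant graphs of order $n$ and degree $p^\ell-1$). *)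

(* Defs.v *)
From mathcomp Require Import all_boot all_algebra.

Set Implicit Arguments.
Unset Strict Implicit.
Unset Printing Implicit Defensive.

Import GRing.Theory.
Local Open Scope ring_scope.

Section Graphs.
Variables (V : finType) (e : rel V).

Definition connected_graph : Prop := forall x y, connect e x y.

Definition regular_of_degree (d : nat) : Prop :=
  forall x, #|[set y | e x y]| = d.

(* For a symmetric [e], [(y == x) || e x y] says that y is at distance at most
   1 from x. *)
Definition perfect_code (D : {set V}) : Prop :=
  forall x, exists! y, y \in D /\ ((y == x) || e x y).

Definition admits_perfect_code : Prop := exists D, perfect_code D.

End Graphs.

Definition isomorphic (V W : finType) (e : rel V) (e' : rel W) : Prop :=
  exists f : V -> W, bijective f /\ forall x y, e' (f x) (f y) = e x y.

Definition connection_set (N : nat) (S : {set 'Z_N}) : Prop :=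
  0 \notin S /\ [set - s | s in S] = S.

Definition cay (N : nat) (S : {set 'Z_N}) : rel 'Z_N :=
  fun x y => x - y \in S.

(* The graph Cay(Z_N, S) as a pair (N, S). Since ['Z_0] and ['Z_1] are Z/2, it
   is meaningful only for N >= 2, which holds for every graph built below when
   p is prime and the entries of l and m are positive. *)
Record circulant := Circulant { circ_order : nat; conn : {set 'Z_circ_order} }.

Definition adj (G : circulant) : rel 'Z_(circ_order G) := cay (conn G).
Arguments adj G : clear implicits.

Definition conn0 (G : circulant) : {set 'Z_(circ_order G)} := 0 |: conn G.

Definition complete_circulant (q : nat) : circulant :=
  @Circulant q [set x | x != 0].

(* T(sigma). The residue s is read as the integer in {0, ..., N-1}, so the
   sum is taken in nat before reduction modulo aN. *)
Definition lift_set (a : nat) (G : circulant)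
    (sigma : 'Z_(circ_order G) -> nat) : {set 'Z_(a * circ_order G)} :=
  [set (s + sigma s * circ_order G)%N%:R | s : 'Z_(circ_order G) in conn G].

(* Only the values of sigma on [conn0 G] matter. *)
Definition feasible (a : nat) (G : circulant)
    (sigma : 'Z_(circ_order G) -> nat) : Prop :=
  [/\ forall s, s \in conn0 G -> (sigma s < a)%N,
      sigma 0 = 0%N
    & [set - x | x in lift_set a sigma] = lift_set a sigma].

Definition fbar (a : nat) (G H : circulant) : Prop :=
  exists sigma : 'Z_(circ_order G) -> nat,
    feasible a sigma /\ H = Circulant (lift_set a sigma).

Definition gbar (a : nat) (G : circulant) : circulant :=
  @Circulant (a * circ_order G)
    ([set (s + i * circ_order G)%N%:R
       | s : 'Z_(circ_order G) in conn0 G, i : 'I_a] :\ 0).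

(* [circ_family p l m G]: G can be obtained as the graph Gamma_1 from
   l = (l_1, ..., l_t) and m = (m_1, ..., m_t). The heads of the lists are l_1
   and m_1, so the construction starts from the last entries. *)
Inductive circ_family (p : nat) : seq nat -> seq nat -> circulant -> Prop :=
| family_last r mt G :
    fbar mt (complete_circulant (p ^ r)%N) G ->
    connected_graph (adj G) ->
    circ_family p [:: r] [:: mt] G
| family_cons li l mi m G H :
    circ_family p l m G ->
    fbar mi (gbar (p ^ li)%N G) H ->
    connected_graph (adj H) ->
    circ_family p (li :: l) (mi :: m) H.

(* Main.v *)
Require Import Defs.
From mathcomp Require Import all_boot all_algebra all_field.

(** A perfect code [D] of Cay(Z_n, S) is the same thing as a tiling
    Z_n = A + D with A = S_0. Since [#|A| = p ^ ell], evaluating the two mask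
    polynomials at a primitive p^j-th root of unity shows that, for each j with
    p^j | n, the p^j-th cyclotomic polynomial divides A(x) or D(x); comparing
    p-adic valuations at x = 1, exactly [ell] of them divide A(x). At these j
    every class of A mod p^(j-1) splits evenly into p classes mod p^j, and by
    counting A does not split at all at the other j (Newman's argument). Reading
    off the levels from the top exhibits A as an iterated lift in which all
    entries of [l] are 1; the required isomorphism is the identity. Conversely,
    both lifting operations pull tilings back along Z_(aN) -> Z_N. *)

Set Implicit Arguments.
Unset Strict Implicit.
Unset Printing Implicit Defensive.

Import GRing.Theory Num.Theory.

(** * Reduction maps between cyclic groups, and perfect codes under the two lifts *)

Section Codes.
Local Open Scope ring_scope.

(** Serves in both directions: if [M] divides [N] it is the quotient homomorphism, and if [N]
    divides [M] it is the section by least residues (see [redK]). *)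
Definition red N M (x : 'Z_N) : 'Z_M := (x : nat)%:R.

Lemma val_red N M (x : 'Z_N) : (1 < M)%N -> red M x = (x %% M)%N :> nat.
Proof. by move=> M_gt1; exact: val_Zp_nat. Qed.

Lemma red_eq N M (x y : 'Z_N) :
  (1 < M)%N -> (red M x == red M y) = (x == y %[mod M])%N.
Proof. by move=> M_gt1; rewrite -val_eqE /= !val_red. Qed.

Section Reduction.
Variables N M : nat.
Hypotheses (N_gt1 : (1 < N)%N) (M_gt1 : (1 < M)%N) (dvdMN : (M %| N)%N).

Lemma red_nat k : red M (k%:R : 'Z_N) = k%:R.
Proof. by apply: val_inj; rewrite /= val_red // !val_Zp_nat // modn_dvdm. Qed.

Lemma redD : {morph @red N M : x y / x + y}.
Proof.
by move=> x y; rewrite -(natr_Zp x) -(natr_Zp y) -natrD !red_nat natrD.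
Qed.

Lemma red0 : red M (0 : 'Z_N) = 0. Proof. exact: (red_nat 0). Qed.

Lemma redN : {morph @red N M : x / - x}.
Proof. by move=> x; apply: (addrI (red M x)); rewrite -redD !subrr red0. Qed.

Lemma redB : {morph @red N M : x y / x - y}.
Proof. by move=> x y; rewrite redD redN. Qed.

Lemma redK (y : 'Z_M) : red M (red N y) = y.
Proof. by rewrite red_nat natr_Zp. Qed.

End Reduction.

Lemma ltn_Zp N (x : 'Z_N) : (1 < N)%N -> (x < N)%N.
Proof. by move=> N_gt1; rewrite -[X in (_ < X)%N](Zp_cast N_gt1). Qed.

Lemma val_addZ N (x y : 'Z_N) : (1 < N)%N -> (x + y)%R = ((x + y) %% N)%N :> nat.
Proof. by move=> N_gt1; rewrite -val_Zp_nat // natrD !natr_Zp. Qed.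

Lemma perfect_codeE N (S : {set 'Z_N}) (D : {set 'Z_N}) :
  perfect_code (cay S) D <->
  forall x, exists! y, y \in D /\ x - y \in 0 |: S.
Proof.
have E x y : (y == x) || cay S x y = (x - y \in 0 |: S).
  by rewrite in_setU1 subr_eq0 eq_sym.
split=> H x; have [y [Hy yP]] := H x; exists y.
  by split=> [|z]; rewrite -E //; apply: yP.
by split=> [|z]; rewrite E //; apply: yP.
Qed.

Lemma isomorphic_perfect_code (V W : finType) (e : rel V) (e' : rel W) :
  isomorphic e e' -> admits_perfect_code e' -> admits_perfect_code e.
Proof.
move=> [f [[g fK gK] ef]] [D Dp]; exists (f @^-1: D) => x.
have [y [[Dy xy] yP]] := Dp (f x).
exists (g y); split=> [|z [Dz xz]].
  by rewrite inE gK -ef gK -(inj_eq (can_inj fK)) gK.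
rewrite (yP (f z)) ?fK // ef (inj_eq (can_inj fK)).
by rewrite inE in Dz.
Qed.

Lemma perfect_code_complete q : admits_perfect_code (adj (complete_circulant q)).
Proof.
exists [set 0]; apply/perfect_codeE => x; exists 0; split=> [|y []].
  by rewrite !inE eqxx subr0 orbN.
by rewrite inE => /eqP.
Qed.

Lemma conn0_gbar a G (x : 'Z_(a * circ_order G)) :
  (1 < circ_order G)%N -> (0 < a)%N ->
  (x \in conn0 (gbar a G)) = (red _ x \in conn0 G).
Proof.
move=> N_gt1 a_gt0; set N := circ_order G.
have aN_gt1 : (1 < a * N)%N by rewrite (leq_trans N_gt1) // leq_pmull.
have dvdN : (N %| a * N)%N by rewrite dvdn_mull.
have [-> | x_neq0] := eqVneq x 0; first by rewrite red0 // !inE !eqxx.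
rewrite in_setU1 (negbTE x_neq0) /= in_setD1 x_neq0 /=.
apply/imset2P/idP => [[s i Gs _ ->] | Gx].
  by rewrite red_nat // natrD natrM pchar_Zp // mulr0 addr0 natr_Zp.
have x_div : (x %/ N < a)%N by rewrite ltn_divLR ?ltn_Zp // ltnW.
exists (red N x) (Ordinal x_div) => //=.
by rewrite val_red // addnC -divn_eq natr_Zp.
Qed.

(** The set S_0 of the blow-up is the full preimage of [conn0 G], so the code needs only one
    representative of each old code element; least residues are taken. *)
Lemma perfect_code_gbar a G : (1 < circ_order G)%N -> (0 < a)%N ->
  admits_perfect_code (adj G) -> admits_perfect_code (adj (gbar a G)).
Proof.
move=> N_gt1 a_gt0 [D /perfect_codeE Dp]; set N := circ_order G in N_gt1 D Dp *.
have aN_gt1 : (1 < a * N)%N by rewrite (leq_trans N_gt1) // leq_pmull.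
have dvdN : (N %| a * N)%N by rewrite dvdn_mull.
exists [set red (a * N) y | y in D]; apply/perfect_codeE => x.
have [d [[Dd xd] dP]] := Dp (red N x).
have E y : (x - red _ y \in conn0 (gbar a G)) = (red N x - y \in conn0 G).
  by rewrite conn0_gbar // redB // redK.
exists (red (a * N) d); split=> [|_ [/imsetP[y Dy ->]]].
  by split; [apply: imset_f | rewrite E].
by rewrite E => xy; rewrite (dP y).
Qed.

Section Fbar.
Variables (a : nat) (G : circulant).
Local Notation N := (circ_order G).
Hypotheses (N_gt1 : (1 < N)%N) (a_gt0 : (0 < a)%N) (G0 : 0 \notin conn G).

Let aN_gt1 : (1 < a * N)%N. Proof. by rewrite (leq_trans N_gt1) // leq_pmull. Qed.
Let dvdN : (N %| a * N)%N. Proof. exact: dvdn_mull. Qed.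

(** Replaces the integer map [sigma] by a section of the reduction onto ['Z_N], the form in which
    tilings are pulled back. *)
Lemma fbarP H : fbar a G H -> exists2 lam : 'Z_N -> 'Z_(a * N),
  cancel lam (red N) & H = Circulant [set lam s | s in conn G] /\ lam 0 = 0.
Proof.
move=> [sigma [[_ sigma0 _] ->]].
exists (fun s : 'Z_N => (s + sigma s * N)%N%:R); last by rewrite sigma0.
by move=> s; rewrite red_nat // natrD natrM pchar_Zp // mulr0 addr0 natr_Zp.
Qed.

Lemma fbar_conn0 H : fbar a G H -> 0 \notin conn H.
Proof.
case/fbarP=> lam lamK [-> lam0] /=; apply/imsetP=> -[s Gs /esym Es].
by case/negP: G0; rewrite -(red0 aN_gt1 N_gt1 dvdN) -Es lamK.
Qed.

(** Dual to the blow-up: here S_0 has one element over each element of [conn0 G], so the code must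
    be the full preimage of the old one. *)
Lemma perfect_code_fbar H :
  fbar a G H -> admits_perfect_code (adj G) -> admits_perfect_code (adj H).
Proof.
case/fbarP=> lam lamK [-> lam0] [D /perfect_codeE Dp].
exists [set y | red N y \in D]; apply/perfect_codeE => x.
have -> : 0 |: [set lam s | s in conn G] = [set lam s | s in conn0 G].
  by rewrite /conn0 imsetU1 lam0.
have [d [[Dd xd] dP]] := Dp (red N x).
(* The code element [d] of the red image of [x] fixes the difference downstairs; its unique lift
   fixes the code element upstairs. *)
exists (x - lam (red N x - d)); split=> [|y []].
  by rewrite inE redB // lamK !subKr imset_f.
rewrite inE => Dy /imsetP[s Gs Es].
have Es' : red N x - red N y = s by rewrite -redB // Es lamK.
by rewrite (dP (red N y)) Es' // -Es subKr.
Qed.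

Lemma fbar_intro (T : {set 'Z_(a * N)}) :
    [set - t | t in T] = T -> 0 \notin T ->
    {in T &, injective (@red (a * N) N)} -> [set red N t | t in T] = conn G ->
  fbar a G (Circulant T).
Proof.
move=> TN T0 T_inj GT.
(* The quotient by [N] of the element of [T] over [s]. The default 0 is what gives [sg 0 = 0], as no
   element of [T] lies over 0. *)
pose sg (s : 'Z_N) := if [pick t in T | red N t == s] is Some t then (t %/ N)%N else 0%N.
have sgT t : t \in T -> (red N t + sg (red N t) * N)%N%:R = t.
  move=> Tt; rewrite /sg; case: pickP => [u /andP[Tu /eqP/T_inj->//] | /(_ t)].
    by rewrite val_red // addnC -divn_eq natr_Zp.
  by rewrite Tt eqxx.
have Tsg : lift_set a sg = T.
  rewrite /lift_set -GT -imset_comp -[RHS]imset_id.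
  by apply: eq_in_imset => t Tt /=; rewrite sgT.
exists sg; split; last by rewrite Tsg.
split; last by rewrite Tsg.
  move=> s _; rewrite /sg; case: pickP => // t _.
  by rewrite ltn_divLR ?ltn_Zp // ltnW.
rewrite /sg; case: pickP => // t /andP[Tt /eqP t0].
by case/negP: G0; rewrite -GT -t0 imset_f.
Qed.
End Fbar.

(** Induction along the construction. The first two conclusions are carried along because each
    lifting lemma asks for them. *)
Lemma family_perfect_code p l ms G : prime p ->
    (forall x, x \in l -> 0 < x)%N -> (forall x, x \in ms -> 0 < x)%N ->
  circ_family p l ms G ->
  [/\ (1 < circ_order G)%N, 0 \notin conn G & admits_perfect_code (adj G)].
Proof.
move=> p_pr l_gt0 m_gt0 fam.
have big q a : (0 < a)%N -> (1 < q)%N -> (1 < a * q)%N.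
  by move=> a0 q1; rewrite (leq_trans q1) // leq_pmull.
elim: fam l_gt0 m_gt0 => {l ms G} [r mt G Gf _|li l mi m G H _ IH Hf _] l_gt0 m_gt0.
  have q1 : (1 < circ_order (complete_circulant (p ^ r)))%N.
    by rewrite /= -(exp1n r) ltn_exp2r ?prime_gt1 // l_gt0 ?mem_head.
  have m0 : (0 < mt)%N by rewrite m_gt0 ?mem_head.
  have K0 : 0 \notin conn (complete_circulant (p ^ r)) by rewrite inE eqxx.
  split.
  - by case: Gf => sg [_ ->]; apply: big.
  - exact: fbar_conn0 Gf.
  - by apply: perfect_code_fbar Gf _ => //; apply: perfect_code_complete.
have [||q1 G0 Gp] := IH.
  by move=> x lx; rewrite l_gt0 // inE lx orbT.
  by move=> x lx; rewrite m_gt0 // inE lx orbT.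
have m0 : (0 < mi)%N by rewrite m_gt0 ?mem_head.
have pl0 : (0 < p ^ li)%N by rewrite expn_gt0 prime_gt0.
have g1 : (1 < circ_order (gbar (p ^ li) G))%N by apply: big.
have g0 : 0 \notin conn (gbar (p ^ li) G) by rewrite !inE eqxx.
split.
- by case: Hf => sg [_ ->]; apply: big.
- exact: fbar_conn0 Hf.
- by apply: perfect_code_fbar Hf _ => //; apply: perfect_code_gbar.
Qed.

(** Walks project to walks that may pause, which is why 0 is allowed as the image of a step. *)
Lemma connected_red N M (S : {set 'Z_N}) (S' : {set 'Z_M}) :
    (1 < N)%N -> (1 < M)%N -> (M %| N)%N ->
    {in S, forall s, red M s \in 0 |: S'} ->
  connected_graph (cay S) -> connected_graph (cay S').
Proof.
move=> N1 M1 dvd sS conS x y.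
rewrite -(redK N1 M1 dvd x) -(redK N1 M1 dvd y).
have /connectP[p] := conS (red N x) (red N y).
elim: p (red N x) => [|v p IH] u /=; first by move=> _ ->.
case/andP=> /sS uv vp e; apply: connect_trans (IH _ vp e).
move: uv; rewrite redB // in_setU1 subr_eq0 => /orP[/eqP-> //|].
exact: connect1.
Qed.

(** Residues mod [q] are constant along walks, and some walk joins 1 to 0. *)
Lemma connected_dvd N q (S : {set 'Z_N}) : (1 < N)%N -> (q %| N)%N ->
  connected_graph (cay S) -> {in S, forall s : 'Z_N, (q %| s)%N} -> q = 1%N.
Proof.
move=> N1 dvd conS qS.
suff: (q %| (1%R : 'Z_N))%N by rewrite dvdn1 => /eqP.
have /connectP[p] := conS 1 0.
elim: p (1 : 'Z_N) => [|v p IH] u /=; first by move=> _ <-; rewrite dvdn0.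
case/andP=> /qS uv vp /(IH _ vp) qv; rewrite -[u](subrK v).
by rewrite val_addZ // /dvdn modn_dvdm // -/(dvdn _ _) dvdn_add.
Qed.

End Codes.

(** * From evenly splitting residue classes to iterated lifts *)

Section Uniform.
Local Open Scope ring_scope.

Lemma card_fibers (T U : finType) (f : T -> U) (A : {set T}) (B : {set U}) :
  #|[set x in A | f x \in B]| = (\sum_(y in B) #|[set x in A | f x == y]|)%N.
Proof.
rewrite -sum1_card (partition_big f (mem B)) /= => [|x]; last first.
  by rewrite inE => /andP[].
apply: eq_bigr => y By; rewrite -sum1_card; apply: eq_bigl => x.
by rewrite !inE; case: eqP => [->|]; rewrite ?andbF // By !andbT.
Qed.

Lemma card_fibers_const (T U : finType) (f : T -> U) (A : {set T}) (B : {set U}) k :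
  {in B, forall y, #|[set x in A | f x == y]| = k} ->
  #|[set x in A | f x \in B]| = (#|B| * k)%N.
Proof. by move=> fib; rewrite card_fibers -sum_nat_const; apply: eq_bigr. Qed.

Lemma opp_setP N (A : {set 'Z_N}) :
  [set - x | x in A] = A <-> {in A, forall x, - x \in A}.
Proof.
split=> [AN x Ax | AN]; first by rewrite -AN imset_f.
apply/setP=> x; apply/imsetP/idP => [[y Ay ->] | Ax]; first exact: AN.
by exists (- x); rewrite ?opprK ?AN.
Qed.

(** [fbar_intro] in terms of S_0: by injectivity 0 is the only element of [A] over 0, so deleting 0
    upstairs matches deleting it downstairs. *)
Lemma fbar_conn0_intro a G (A : {set 'Z_(a * circ_order G)}) :
    (1 < circ_order G)%N -> (0 < a)%N -> 0 \notin conn G ->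
    0 \in A -> {in A, forall x, - x \in A} ->
    {in A &, injective (@red (a * circ_order G) (circ_order G))} ->
    [set red _ x | x in A] = conn0 G ->
  fbar a G (Circulant (A :\ 0)).
Proof.
move=> N1 a0 G0 A0 AN Ainj EA.
have aN1 : (1 < a * circ_order G)%N by rewrite (leq_trans N1) // leq_pmull.
have r0 : red _ (0 : 'Z_(a * circ_order G)) = 0 :> 'Z_(circ_order G).
  by rewrite red0 ?dvdn_mull.
apply: fbar_intro => //; last 1 first.
- apply/setP=> y; have := in_setU1 y 0 (conn G); rewrite -/(conn0 G) -EA.
  have [-> _ | y0 /= <-] := eqVneq y 0.
    rewrite (negbTE G0); apply/imsetP=> -[t]; rewrite !inE => /andP[/eqP t0 At].
    by rewrite -r0 => /Ainj ett; apply: t0; rewrite ett.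
  apply/imsetP/imsetP=> -[x Ax Ey]; exists x => //; first by move: Ax; rewrite inE => /andP[].
  by rewrite !inE Ax andbT; apply: contraNneq y0 => x0; rewrite Ey x0 r0.
- apply/opp_setP => x; rewrite !inE oppr_eq0 => /andP[-> /AN].
  by [].
- by rewrite !inE eqxx.
- by move=> x y; rewrite !inE => /andP[_ Ax] /andP[_ Ay]; apply: Ainj.
Qed.

Lemma card_red_fiber a N (y : 'Z_N) : (0 < a)%N -> (1 < N)%N ->
  (#|[set x : 'Z_(a * N) | red N x == y]| <= a)%N.
Proof.
move=> a_gt0 N1.
have aN1 : (1 < a * N)%N by rewrite (leq_trans N1) // leq_pmull.
rewrite -[X in (_ <= X)%N]card_ord -cardsT.
apply: leq_trans (leq_imset_card (fun i : 'I_a => (y + i * N)%N%:R : 'Z_(a * N)) _).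
apply/subset_leq_card/subsetP=> x; rewrite inE => /eqP <-.
have x_div : (x %/ N < a)%N by rewrite ltn_divLR ?ltn_Zp // ltnW.
apply/imsetP; exists (Ordinal x_div) => //=.
by rewrite val_red // addnC -divn_eq natr_Zp.
Qed.

Definition mod_class N (A : {set 'Z_N}) q (a : nat) : {set 'Z_N} :=
  [set x : 'Z_N in A | (x == a %[mod q])%N].

(** Here [h j] counts the levels up to [j] at which [A] splits, so every class of [A] mod p^j has
    p^(ell - h j) elements. Induction on [s] removes the top level. Only divisibility of [N] by p^s
    is asked, so that [N] may retain factors that go into the next entry of [ms]. *)
Lemma family_of_uniform p s N (A : {set 'Z_N}) ell (h : nat -> nat) :
    prime p -> (1 < N)%N -> (p ^ s %| N)%N ->
    0 \in A -> {in A, forall x, - x \in A} -> connected_graph (cay (A :\ 0)) ->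
    h 0%N = 0%N -> (forall j, h j.+1 = h j \/ h j.+1 = (h j).+1) ->
    h s = ell -> (0 < ell)%N ->
    (forall (a : 'Z_N) j, a \in A -> (j <= s)%N ->
      (#|mod_class A (p ^ j) a| * p ^ h j = p ^ ell)%N) ->
  exists l ms : seq nat,
    [/\ size l = size ms,
        (forall x, x \in l -> 0 < x)%N /\ (forall x, x \in ms -> 0 < x)%N,
        (\sum_(x <- l) x = ell)%N,
        (p ^ ell * \prod_(x <- ms) x = N)%N
      & circ_family p l ms (Circulant (A :\ 0))].
Proof.
move=> p_pr + + + + + h0 hS.
have p_gt0 := prime_gt0 p_pr.
have pX k : (0 < p ^ k)%N by rewrite expn_gt0 p_gt0.
elim: s N A ell => [|s IH] N A ell N1 dvdN A0 AN conA hs ell_gt0 unif.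
  by rewrite -hs h0 in ell_gt0.
have dvds : (p ^ s %| N)%N by apply: dvdn_trans dvdN; rewrite dvdn_exp2l.
case: (hS s) => hs1.
  (* No splitting at the top level: [A] and [N] stay, and the extra factor p is absorbed later into
     an entry of [ms]. *)
  apply: IH => //; first by rewrite -hs1.
  by move=> a j Aa js; apply: unif => //; apply: leqW.
have cardA : #|A| = (p ^ ell)%N.
  rewrite -(unif 0 0%N) // h0 muln1; congr (#|pred_of_set _|).
  by apply/setP=> x; rewrite !inE !modn1 eqxx andbT.
(* At the top level [h] has reached [ell], so classes are singletons. *)
have Ainj : {in A &, injective (@red N (p ^ s.+1))}.
  have M1 : (1 < p ^ s.+1)%N by rewrite -(exp1n s.+1) ltn_exp2r ?prime_gt1.
  move=> x y Ax Ay /eqP; rewrite red_eq // => xy.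
  have := unif x _ Ax (leqnn _); rewrite hs => /eqP.
  rewrite -[X in _ == X]mul1n eqn_pmul2r // => /eqP c1.
  by apply/esym; apply/(@card_le1_eqP _ (mod_class A (p ^ s.+1) x));
     rewrite ?c1 // !inE ?Ax ?Ay ?eqxx // eq_sym.
have AM x : x \in A -> #|mod_class A (p ^ s) x| = p.
  move=> Ax; have := unif x s Ax (leqnSn _).
  by rewrite -hs hs1 expnS => /eqP; rewrite eqn_pmul2r // => /eqP.
(* If this is the only splitting level, [A] has p elements, all in the class of 0 mod p^s.
   Connectedness then forces s = 0, and [A] reduces bijectively onto Z_p: a lift of the complete
   graph. *)
have [k1 | k1] := posnP (h s).
  have ell1 : ell = 1%N by rewrite -hs hs1 k1.
  have s0 : s = 0%N.
    have /eqP : (p ^ s)%N = 1%N.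
      apply: connected_dvd conA _ => // x; rewrite inE => /andP[_ Ax].
      have: x \in mod_class A (p ^ s) 0.
        suff -> : mod_class A (p ^ s) 0 = A by [].
        apply/eqP; rewrite eqEcard (AM 0) // cardA ell1 leqnn andbT.
        by apply/subsetP=> y; rewrite inE => /andP[].
      by rewrite inE mod0n => /andP[].
    by rewrite -(expn0 p) eqn_exp2l ?prime_gt1 // => /eqP.
  rewrite ell1 in cardA *; subst s.
  have [a Na] := dvdnP dvdN; subst N.
  have a_gt0 : (0 < a)%N by case: (a) N1.
  have M1 : (1 < p ^ 1)%N by rewrite expn1 prime_gt1.
  exists [:: 1%N], [:: a]; split=> //.
  - by split=> x; rewrite inE => /eqP->.
  - by rewrite big_seq1.
  - by rewrite big_seq1 mulnC.
  - constructor=> //; apply: fbar_conn0_intro => //=; first by rewrite inE eqxx.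
    apply/eqP; rewrite eqEcard; apply/andP; split.
      by apply/subsetP=> x; rewrite !inE orbN.
    rewrite card_in_imset // cardA.
    by rewrite (leq_trans (max_card _)) // card_ord Zp_cast.
have s_gt0 : (0 < s)%N by case: (s) k1; rewrite ?h0.
have q1 : (1 < p ^ s)%N by rewrite -(exp1n s) ltn_exp2r ?prime_gt1.
(* [p ^ 1] is left unsimplified to match the order of [gbar (p ^ 1)]. *)
pose q := (p ^ s)%N; have E : (p ^ s.+1 = p ^ 1 * q)%N by rewrite expn1 expnS.
rewrite E in Ainj.
have [a Na] : exists a, N = (a * (p ^ 1 * q))%N by rewrite -E; apply/dvdnP.
subst N; have a_gt0 : (0 < a)%N by case: (a) N1.
pose A' := [set red q x | x in A].
have r0 : red q (0 : 'Z_(a * (p ^ 1 * q))) = 0 by apply: red0.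
have A'0 : 0 \in A' by rewrite -r0 imset_f.
have fib y : y \in A' -> #|[set x in A | red q x == y]| = p.
  case/imsetP=> x Ax ->; apply: etrans (AM x Ax); congr (#|pred_of_set _|).
  by apply/setP=> z; rewrite !inE red_eq.
have cardA' : (#|A'| * p)%N = #|A|.
  rewrite -(card_fibers_const fib).
  by congr (#|pred_of_set _|); apply/setP=> x; rewrite inE andb_idr // => /(imset_f (red q)).
have [|||||||l [ms [sz [l0 m0] suml prodm fam]]] := IH q A' (h s) q1.
- exact: dvdnn.
- exact: A'0.
- move=> _ /imsetP[x Ax ->]; rewrite -redN //; exact/imset_f/AN.
- apply: connected_red conA => // x; rewrite !inE => /andP[_ Ax].
  by case: eqVneq => //= _; apply: imset_f.
- by [].
- by [].
(* A class of [A] mod p^j is the preimage of that of [A'], and all fibres of [A] over [A'] have p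
   elements. *)
- move=> _ j /imsetP[x Ax ->] js; apply/eqP; rewrite -(eqn_pmul2r p_gt0) -expnSr -hs1 hs.
  rewrite -(unif x j) ?(leqW js) // mulnAC; apply/eqP; congr (_ * _)%N.
  rewrite -(card_fibers_const (f := @red _ q) (A := A)) => [|y]; last first.
    by rewrite inE => /andP[/fib].
   congr (#|pred_of_set _|); apply/setP=> z.
  rewrite !inE; case Az: (z \in A) => //=; rewrite (imset_f _ Az) /= !val_red //.
  by rewrite !modn_dvdm // dvdn_exp2l.
exists (1%N :: l), (a :: ms); split=> //.
- by rewrite /= sz.
- by split=> x; rewrite inE => /orP[/eqP-> // |]; [apply: l0 | apply: m0].
- by rewrite big_cons suml -hs hs1 add1n.
- by rewrite big_cons mulnCA -hs hs1 expnS -mulnA prodm -expnS.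
apply: (family_cons fam) => //.
set G := Circulant (A' :\ 0).
have GA : conn0 G = A' by rewrite /conn0 setD1K.
have G1 : (1 < circ_order (gbar (p ^ 1) G))%N by rewrite /= -E -(exp1n s.+1) ltn_exp2r ?prime_gt1.
apply: fbar_conn0_intro => //; first by rewrite !inE eqxx.
(* The image of [A] lies in the preimage of [A'], which has at most p elements over each point,
   hence at most as many as [A]; injectivity gives equality. *)
apply/eqP; rewrite eqEcard; apply/andP; split.
  apply/subsetP=> _ /imsetP[x Ax ->]; rewrite conn0_gbar // GA.
  have -> : red (circ_order G) (red (circ_order (gbar (p ^ 1) G)) x) = red q x.
    by apply/val_inj; rewrite /= !val_red // modn_dvdm // dvdn_mull.
  exact: imset_f.
rewrite card_in_imset // -cardA'.
have -> : conn0 (gbar (p ^ 1) G) = [set x in [set: 'Z_(p ^ 1 * q)] | red q x \in A'].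
  by apply/setP=> x; rewrite conn0_gbar // GA !inE.
rewrite card_fibers -sum_nat_const; apply: leq_sum => y _.
rewrite -[X in (_ <= X)%N](expn1 p) (leq_trans _ (card_red_fiber y (pX 1%N) q1)) //.
by apply/subset_leq_card/subsetP=> x; rewrite !inE.
Qed.
End Uniform.

(** * Cyclotomic polynomials of prime-power order and the residue classes of a set *)

Section Cyclo.
Local Open Scope ring_scope.
Local Notation pZtoC := (map_poly (intr : int -> algC)).

(** Both sides are the value at one polynomial of a linear functional [L]: the sum of the
    coefficients with index congruent to [c]. The bound [B] exceeds all exponents. *)
Lemma sum_coef_mod (I J : finType) (P : pred I) (Q : pred J)
    (a : I -> int) (b : J -> int) (e : I -> nat) (f : J -> nat) M c :
  \sum_(i | P i) a i *: 'X^(e i) = \sum_(j | Q j) b j *: 'X^(f j) ->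
  \sum_(i | P i && (e i == c %[mod M])%N) a i =
  \sum_(j | Q j && (f j == c %[mod M])%N) b j.
Proof.
pose B := ((\sum_i e i + \sum_j f j).+1)%N.
pose L (R : {poly int}) := \sum_(k < B | (k == c %[mod M])%N) R`_k.
have LE (K : finType) (S : pred K) (w : K -> int) (g : K -> nat) :
    (forall k, g k < B)%N ->
    L (\sum_(k | S k) w k *: 'X^(g k)) = \sum_(k | S k && (g k == c %[mod M])%N) w k.
  move=> gB; rewrite /L; under eq_bigr do rewrite coef_sum.
  rewrite exchange_big big_mkcondr /=; apply: eq_bigr => k _.
  under eq_bigr do rewrite coefZ coefXn.
  case: ifP => ck.
    rewrite (bigD1 (Ordinal (gB k))) //= eqxx mulr1 big1 ?addr0 // => i /andP[_ ik].
    by rewrite -val_eqE /= in ik; rewrite (negbTE ik) mulr0.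
  rewrite big1 // => i ci; case: eqP => [ik|]; last by rewrite mulr0.
  by rewrite -ik ci in ck.
have le_sum (K : finType) (g : K -> nat) k : (g k <= \sum_i g i)%N.
  by rewrite (bigD1 k) //= leq_addr.
move=> /(congr1 L); rewrite !LE // => k; rewrite /B ltnS.
  by rewrite (leq_trans (le_sum _ f k)) ?leq_addl.
by rewrite (leq_trans (le_sum _ e k)) ?leq_addr.
Qed.

Variable p : nat.
Hypothesis p_pr : prime p.
Let p_gt0 : (0 < p)%N := prime_gt0 p_pr.

Definition Psi j : {poly int} := \sum_(i < p) 'X^(i * p ^ j).

(** After multiplication by X^(p^j) - 1 both sides equal X^(p^(j+1)) - 1, because p^(j+1) has just
    one divisor that does not divide p^j. *)
Lemma PsiE j : Psi j = 'Phi_(p ^ j.+1).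
Proof.
have pj k : (0 < p ^ k)%N by rewrite expn_gt0 p_gt0.
have nz : ('X^(p ^ j) - 1 : {poly int}) != 0.
  by rewrite monic_neq0 // monicXnsubC.
apply: (mulfI nz).
have -> : Psi j = \sum_(i < p) ('X^(p ^ j)) ^+ i.
  by apply: eq_bigr => i _; rewrite -exprM mulnC.
rewrite -subrX1 -exprM -expnSr -!prod_Cyclotomic //.
rewrite mulrC -(big_cons _ _ _ _ xpredT) /=; apply: perm_big.
apply: uniq_perm; rewrite /= ?divisors_uniq ?andbT //.
  rewrite -dvdn_divisors //; apply/negP => /(dvdn_leq (pj j)).
  by rewrite leq_exp2l ?prime_gt1 // ltnn.
move=> d; rewrite inE -!dvdn_divisors //; apply/idP/orP.
  case/(dvdn_pfactor _ _ p_pr) => k; rewrite leq_eqVlt => /orP[/eqP-> ->|kj ->].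
    by left.
  by right; rewrite dvdn_exp2l.
by case=> [/eqP->|/dvdn_trans-> //]; rewrite ?dvdn_exp2l.
Qed.

Lemma Psi1 j : (Psi j).[1] = p%:R.
Proof.
rewrite horner_sum; under eq_bigr do rewrite hornerXn expr1n.
by rewrite sumr_const card_ord.
Qed.

Lemma Psi_root j (z z' : algC) : (p ^ j.+1).-primitive_root z ->
  root (pZtoC (Psi j)) z' = (p ^ j.+1).-primitive_root z'.
Proof. by move=> zp; rewrite PsiE (Cintr_Cyclotomic zp) root_cyclotomic. Qed.

(** Division by the monic [Psi j] stays over the integers. Its remainder vanishes at [z] and has
    degree below that of the minimal polynomial of [z], so it is zero. *)
Lemma Psi_dvd j (z : algC) P : (p ^ j.+1).-primitive_root z ->
  root (pZtoC P) z -> exists Q, P = Q * Psi j.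
Proof.
move=> zp Pz; have mPsi : Psi j \is monic by rewrite PsiE Cyclotomic_monic.
have := Pdiv.RingMonic.rdivp_eq mPsi P.
set Q := Pdiv.Ring.rdivp _ _; set R := Pdiv.Ring.rmodp _ _ => E.
exists Q; rewrite {1}E; suff -> : R = 0 by rewrite addr0.
have Rz : root (pZtoC R) z.
  have : root (pZtoC (P - Q * Psi j)) z.
    rewrite rmorphB rmorphM /= rootE !hornerE (rootP Pz).
    have /rootP -> : root (pZtoC (Psi j)) z by rewrite (Psi_root _ zp).
    by rewrite mulr0 subr0.
  by rewrite {1}E addrAC subrr add0r.
have [pf [Dpf mpf] /(_ (map_poly intr R))] := minCpolyP z.
have -> : map_poly ratr (map_poly intr R) = pZtoC R.
  by rewrite -map_poly_comp; apply: eq_map_poly => x /=; rewrite rmorph_int.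
rewrite Rz => /esym pfR.
apply/eqP; apply: contraTT isT => R0.
have sz : size pf = size (Psi j).
  rewrite -(size_map_poly (ratr : {rmorphism rat -> algC})) -Dpf (minCpoly_cyclotomic zp).
  by rewrite size_cyclotomic PsiE size_Cyclotomic.
have szR : size (map_poly (intr : int -> rat) R) = size R.
  by rewrite size_map_inj_poly //; apply: intr_inj.
have : (size pf <= size R)%N.
  by rewrite -szR dvdp_leq // -size_poly_eq0 szR size_poly_eq0.
by rewrite sz leqNgt Pdiv.Ring.ltn_rmodpN0 // monic_neq0.
Qed.

Lemma zeta_ex j : {z : algC | (p ^ j.+1).-primitive_root z}.
Proof. by apply: C_prim_root_exists; rewrite expn_gt0 p_gt0. Qed.

(* Indices are shifted: [zeta j] has order [p ^ j.+1]. *)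
Definition zeta j := sval (zeta_ex j).

Lemma zetaP j : (p ^ j.+1).-primitive_root (zeta j).
Proof. exact: svalP (zeta_ex j). Qed.

(** Each index splits off a factor [Psi j], worth p at 1. The other roots pass to the quotient,
    since primitive roots of different orders are roots of different [Psi]. *)
Lemma dvdz_horner1 (J : seq nat) P : uniq J ->
  {in J, forall j, root (pZtoC P) (zeta j)} ->
  exists u : int, P.[1] = u * p%:R ^+ size J.
Proof.
elim: J P => [|j J IH] P /=; first by exists P.[1]; rewrite mulr1.
case/andP=> jJ uJ rP.
have [Q EQ] := Psi_dvd (zetaP j) (rP j (mem_head _ _)).
have [|u Eu] := IH Q uJ.
  move=> i iJ; have := rP i; rewrite inE iJ orbT => /(_ isT).
  rewrite EQ rmorphM /= rootM (Psi_root _ (zetaP j)) => /orP[//|].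
  move=> ip; case/negP: jJ; suff -> : j = i by [].
  apply/eqP; rewrite -eqSS -(eqn_exp2l _ _ (prime_gt1 p_pr)) eqn_dvd.
  by rewrite (prim_order_dvd ip) (prim_order_dvd (zetaP i)) (prim_expr_order ip)
    (prim_expr_order (zetaP i)) eqxx.
by exists u; rewrite EQ hornerM Eu Psi1 exprSr mulrA.
Qed.

(** The numbers k + iq with i < p run exactly once through the classes mod pq lying over that of [k]
    mod q. *)
Lemma card_eq_mod q k c : (0 < q)%N ->
  #|[pred i : 'I_p | (k + i * q == c %[mod p * q])%N]| = (k == c %[mod q])%N.
Proof.
move=> q_gt0; case: eqP => [kc|kc]; last first.
  apply: eq_card0 => i; apply/negP; rewrite inE => /eqP kic; apply: kc.
  rewrite -(modnMDl i) addnC -(modn_dvdm (k + i * q) (dvdn_mull p (dvdnn q))) kic.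
  by rewrite modn_dvdm // dvdn_mull.
(* Adding a multiple of pq to [c] keeps its class and makes the natural-number subtraction of [k]
   exact. *)
have le : (k <= c + p * q * k)%N.
  by rewrite (leq_trans _ (leq_addl _ _)) // leq_pmull // muln_gt0 p_gt0.
have [e Ee] : exists e, (c + p * q * k = k + e * q)%N.
  have : (q %| c + p * q * k - k)%N.
    rewrite -eqn_mod_dvd //; apply/eqP; rewrite kc addnC mulnAC modnMDl //.
  by case/dvdnP=> e Ee; exists e; rewrite -Ee subnKC.
apply: etrans (card1 (Ordinal (ltn_pmod e p_gt0))); apply: eq_card => i.
rewrite !inE -val_eqE /=.
have -> : (c %% (p * q) = (k + e * q) %% (p * q))%N.
  by rewrite -Ee addnC [(p * q * k)%N]mulnC modnMDl.
by rewrite eqn_modDl -!muln_modl eqn_pmul2r // (modn_small (ltn_ord i)).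
Qed.

Definition set_poly N (A : {set 'Z_N}) : {poly int} := \sum_(x in A) 'X^x.

Lemma set_poly1 N (A : {set 'Z_N}) : (set_poly A).[1] = #|A|%:R.
Proof.
rewrite horner_sum; under eq_bigr do rewrite hornerXn expr1n.
by rewrite sumr_const.
Qed.

Lemma horner_set_poly N (A : {set 'Z_N}) (z : algC) :
  (pZtoC (set_poly A)).[z] = \sum_(x in A) z ^+ x.
Proof.
rewrite rmorph_sum /= horner_sum; apply: eq_bigr => x _.
by rewrite map_polyXn hornerXn.
Qed.

(** In A(x) = Q(x) Psi_j(x) the factor Psi_j spreads each coefficient of Q equally over the p
    classes mod p^(j+1) inside its class mod p^j. *)
Lemma card_class_zeta N (A : {set 'Z_N}) j c : root (pZtoC (set_poly A)) (zeta j) ->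
  #|mod_class A (p ^ j) c| = (#|mod_class A (p ^ j.+1) c| * p)%N.
Proof.
set q := (p ^ j)%N => /(Psi_dvd (zetaP j))[Q EQ].
have q_gt0 : (0 < q)%N by rewrite expn_gt0 p_gt0.
have EA : \sum_(x in A) (1 : int) *: 'X^x =
    \sum_(u : 'I_(size Q) * 'I_p) Q`_u.1 *: 'X^(u.1 + u.2 * q).
  under eq_bigr do rewrite scale1r.
  rewrite -/(set_poly A) EQ -[Q in LHS]coefK poly_def mulr_suml.
  rewrite -(pair_bigA _ (fun (k : 'I_(size Q)) (i : 'I_p) =>
    Q`_k *: 'X^(k + i * q))) /=.
  apply: eq_bigr => k _; rewrite mulr_sumr; apply: eq_bigr => i _.
  by rewrite -scalerAl -exprD.
have classE M : (#|mod_class A M c|%:R : int) =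
    \sum_(k < size Q) Q`_k * #|[pred i : 'I_p | (k + i * q == c %[mod M])%N]|%:R.
  transitivity (\sum_(x in A | (x == c %[mod M])%N) (1 : int)).
    by rewrite sumr_const; congr (_%:R); apply: eq_card => x; rewrite !inE.
  rewrite (sum_coef_mod _ _ EA) big_mkcond.
  rewrite -(pair_bigA _ (fun (k : 'I_(size Q)) (i : 'I_p) =>
    if (k + i * q == c %[mod M])%N then Q`_k else 0)) /=.
  apply: eq_bigr => k _; rewrite -big_mkcond /= sumr_const.
  by rewrite mulr_natr.
have qE k : #|[pred i : 'I_p | (k + i * q == c %[mod q])%N]| =
    ((k == c %[mod q])%N * p)%N.
  rewrite (eq_card (B := [pred i : 'I_p | (k == c %[mod q])%N])) => [|i].
    by case: eqP => _; rewrite ?mul1n ?card_ord // mul0n; apply: eq_card0.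
  by rewrite !inE addnC modnMDl.
apply/eqP; rewrite -(eqr_nat int) natrM !classE mulr_suml; apply/eqP.
by apply: eq_bigr => k _; rewrite qE expnS card_eq_mod // natrM mulrA.
Qed.

End Cyclo.

(** * Tilings of Z_n evaluated at roots of unity *)

Section Tiling.
Local Open Scope ring_scope.
Local Notation pZtoC := (map_poly (intr : int -> algC)).
Variables (n : nat) (A D : {set 'Z_n}).
Hypotheses (n_gt1 : (1 < n)%N).
Hypothesis tiling : forall x, exists! y, y \in D /\ x - y \in A.

(** As z^n = 1, exponents add modulo n, and the tiling writes each residue once as a sum. The ring
    is general because the identity is used in [int] at 1 and in [algC]. *)
Lemma tiling_sum (R : comNzRingType) (z : R) : z ^+ n = 1 ->
  (\sum_(x in A) z ^+ x) * (\sum_(y in D) z ^+ y) = \sum_(x : 'Z_n) z ^+ x.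
Proof.
move=> zn.
have zD (x y : 'Z_n) : z ^+ (x + y)%R = z ^+ x * z ^+ y.
  by rewrite val_addZ // -exprD [in RHS](divn_eq (x + y) n) exprD mulnC exprM zn expr1n mul1r.
transitivity (\sum_(x : 'Z_n) \sum_(y in D | x - y \in A) z ^+ x).
  rewrite (exchange_big_dep (mem D)) /= => [|x y _ /andP[] //].
  rewrite mulr_sumr; apply: eq_bigr => y Dy.
  rewrite mulr_suml [RHS](reindex_inj (addIr y)); apply: eq_big => x.
    by rewrite /= addrK Dy.
  by rewrite zD.
apply: eq_bigr => x _; have [y [[Dy xy] yP]] := tiling x.
rewrite (big_pred1 y) // => w /=; apply/andP/eqP => [H|-> //].
by rewrite (yP w).
Qed.

Lemma tiling_card : (#|A| * #|D| = n)%N.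
Proof.
have E (P : pred 'Z_n) : \sum_(x | P x) (1 : int) ^+ x = #|P|%:R.
  by under eq_bigr do rewrite expr1n; rewrite sumr_const.
have := tiling_sum (expr1n int n); rewrite !E -natrM => /eqP.
by rewrite eqr_nat => /eqP->; rewrite -[RHS](Zp_cast n_gt1) -[RHS]card_ord; apply: eq_card.
Qed.

Lemma tiling_root (z : algC) : z ^+ n = 1 -> z != 1 ->
  root (pZtoC (set_poly A)) z || root (pZtoC (set_poly D)) z.
Proof.
move=> zn z1; rewrite !rootE !horner_set_poly -mulf_eq0 tiling_sum //.
(* The right side of [tiling_sum] is a geometric sum; [(Zp_trunc n).+2] is n as it appears in the
   type ['Z_n]. *)
have := subrX1 z (Zp_trunc n).+2; rewrite {1}Zp_cast // zn subrr => /esym/eqP.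
by rewrite mulf_eq0 subr_eq0 (negbTE z1).
Qed.

End Tiling.

(** * Counting cyclotomic divisors of prime-power order, after Newman *)

Section Newman.
Local Open Scope ring_scope.
Local Notation pZtoC := (map_poly (intr : int -> algC)).
Variables (p n ell : nat) (A D : {set 'Z_n}).
Hypotheses (p_pr : prime p) (n_gt1 : (1 < n)%N).
Hypothesis tiling : forall x, exists! y, y \in D /\ x - y \in A.
Hypothesis cardA : #|A| = (p ^ ell)%N.

(** The number of i with 1 <= i <= j such that the p^i-th cyclotomic polynomial divides the mask
    polynomial of [B]; for [A] it becomes the [h] of [family_of_uniform]. *)
Definition zero_count (B : {set 'Z_n}) j :=
  count (fun i => root (pZtoC (set_poly B)) (zeta p_pr i)) (iota 0 j).

Lemma zero_countS B j : zero_count B j.+1 =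
  (zero_count B j + root (pZtoC (set_poly B)) (zeta p_pr j))%N.
Proof. by rewrite /zero_count -addn1 iotaD count_cat /= add0n addn0. Qed.

Lemma zero_count_le B j : B != set0 -> (zero_count B j <= logn p #|B|)%N.
Proof.
move=> B0; set J := [seq i <- iota 0 j | root (pZtoC (set_poly B)) (zeta p_pr i)].
have [||u Eu] := @dvdz_horner1 p p_pr J (set_poly B).
- by rewrite filter_uniq ?iota_uniq.
- by move=> i; rewrite mem_filter => /andP[].
have {Eu} : (#|B| = `|u| * p ^ zero_count B j)%N.
  by rewrite set_poly1 size_filter in Eu; rewrite -[LHS]absz_nat -natz Eu abszM -natrX natz absz_nat.
have B_gt0 : (0 < #|B|)%N by rewrite card_gt0.
by move=> E; rewrite -pfactor_dvdn // E dvdn_mull.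
Qed.

(** The counts for [A] and [D] are at most the p-adic valuations of their sizes, which add up to
    that of n. As every level is counted at least once, both bounds are attained. *)
Lemma zero_count_tiling : zero_count A (logn p n) = ell.
Proof.
have n_gt0 : (0 < n)%N by apply: ltnW.
have cardAD := tiling_card n_gt1 tiling.
have /andP[A_gt0 D_gt0] : (0 < #|A|)%N && (0 < #|D|)%N by rewrite -muln_gt0 cardAD.
apply/eqP; rewrite eqn_leq; apply/andP; split.
  apply: leq_trans (zero_count_le _ _) _; first by rewrite -card_gt0.
  by rewrite cardA pfactorK.
have lD : (zero_count D (logn p n) <= logn p #|D|)%N.
  by rewrite zero_count_le // -card_gt0.
have lE : logn p n = (ell + logn p #|D|)%N.
  by rewrite -{1}cardAD lognM // cardA pfactorK.
rewrite -(leq_add2r (logn p #|D|)) -lE.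
apply: leq_trans _ (leq_add (leqnn _) lD).
rewrite /zero_count -count_predUI (leq_trans _ (leq_addr _ _)) //.
rewrite -{1}(size_iota 0 (logn p n)) -[X in (X <= _)%N]count_predT.
rewrite leq_eqVlt; apply/orP; left; apply/eqP/eq_in_count => i /=.
rewrite mem_iota add0n /= => i_lt; apply/esym.
have zp := zetaP p_pr i.
apply: tiling_root => //.
  apply/eqP; rewrite -(prim_order_dvd zp) pfactor_dvdn //.
rewrite -[zeta _ _]expr1 -(prim_order_dvd zp) dvdn1 -(expn0 p).
by rewrite eqn_exp2l ?prime_gt1.
Qed.

(* The sequence [#|class of a mod p^j| * p ^ zero_count A j] is nonincreasing
   in [j], and its extreme values are both [p ^ ell]. *)
Lemma tiling_uniform (a : 'Z_n) j : a \in A -> (j <= logn p n)%N ->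
  (#|mod_class A (p ^ j) a| * p ^ zero_count A j = p ^ ell)%N.
Proof.
move=> Aa js; pose u i := (#|mod_class A (p ^ i) a| * p ^ zero_count A i)%N.
have uS i : (u i.+1 <= u i)%N.
  rewrite /u zero_countS; case: (boolP (root _ _)) => r; last first.
    rewrite addn0 leq_mul2r; apply/orP; right; apply/subset_leq_card/subsetP=> x.
    rewrite !inE => /andP[-> /eqP E] /=; apply/eqP.
    have dvd : (p ^ i %| p ^ i.+1)%N by rewrite dvdn_exp2l.
    by rewrite -(modn_dvdm x dvd) E modn_dvdm.
  by rewrite (card_class_zeta _ r) /= addn1 -mulnA -expnS.
have u_le i k : (u (i + k) <= u i)%N.
  by elim: k => [|k IH]; rewrite ?addn0 // addnS (leq_trans (uS _)).
have u0 : u 0%N = (p ^ ell)%N.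
  rewrite /u muln1 -cardA; apply: eq_card => x.
  by rewrite !inE !modn1 eqxx andbT.
apply/eqP; rewrite eqn_leq -{1}u0 (u_le 0%N j) /=.
(* At the last level the class still contains [a], so the value there is at least p^ell. *)
apply: leq_trans _ (u_le j (logn p n - j)%N); rewrite subnKC // /u zero_count_tiling.
by rewrite leq_pmull // card_gt0; apply/set0Pn; exists a; rewrite inE Aa eqxx.
Qed.
End Newman.

Theorem theorem1p3 (p ell m n : nat) (p_prime : prime p)
    (ell_ge1 : 1 <= ell) (m_ge2 : 2 <= m) (n_def : n = p ^ ell * m)
    (S : {set 'Z_n}) (S_conn : connection_set S)
    (cay_connected : connected_graph (cay S))
    (cay_degree : regular_of_degree (cay S) (p ^ ell - 1)) :
  admits_perfect_code (cay S) <->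
  exists l ms : seq nat,
    [/\ size l = size ms,
        (forall x, x \in l -> 0 < x) /\ (forall x, x \in ms -> 0 < x),
        \sum_(x <- l) x = ell,
        \prod_(x <- ms) x = m
      & exists G : circulant, circ_family p l ms G /\ isomorphic (cay S) (adj G)].
Proof.
have pl_gt0 : 0 < p ^ ell by rewrite expn_gt0 prime_gt0.
have n_gt1 : 1 < n by rewrite n_def (leq_trans m_ge2) // leq_pmull.
split; last first.
  case=> l [ms [_ [l_gt0 m_gt0] _ _ [G [famG /isomorphic_perfect_code]]]]; apply.
  by have [] := family_perfect_code p_prime l_gt0 m_gt0 famG.
case=> D /perfect_codeE tiling.
have [S0 /opp_setP oppS] := S_conn.
set A := (0%R |: S) in tiling.
have AS : A :\ 0%R = S by rewrite setU1K.
have cardA : #|A| = p ^ ell.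
  (* The degree is read off at the vertex 0, whose neighbours form -S = S. *)
  rewrite cardsU1 S0 -(subnKC pl_gt0) -(cay_degree 0%R); congr (_ + _).
  apply: eq_card => x; rewrite inE /cay sub0r.
  by apply/idP/idP => /oppS; rewrite ?opprK.
(* All levels of the p-part of n are used, with [zero_count] recording where [A] splits. *)
have [|||||||||l [ms [sz pos sl pm fam]]] :=
  @family_of_uniform p (logn p n) n A ell (zero_count p_prime A) p_prime n_gt1.
- by rewrite pfactor_dvdnn.
- by rewrite !inE eqxx.
- move=> x; rewrite !inE oppr_eq0 => /orP[-> //|Sx].
  by rewrite oppS ?orbT.
- by rewrite AS.
- by [].
- move=> j; rewrite zero_countS.
  by case: root; [right; rewrite addn1 | left; rewrite addn0].
- exact: zero_count_tiling tiling cardA.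
- by [].
- by move=> a j Aa js; apply: tiling_uniform tiling cardA _ _ Aa js.
exists l, ms; split=> //.
  by apply/eqP; rewrite -(eqn_pmul2l pl_gt0) pm n_def.
exists (Circulant (A :\ 0%R)); split=> //; rewrite AS.
by exists id; split=> //; exists id.
Qed.
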